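(* Let $\mathcal H\cong\mathbb C^d$ and let $\mathbb F=\{F_i\}_i$ and $\mathbb G=\{G_i\}_i$ be POVMs on $\mathcal H$. Then $\mathbb F$ is a parent of $\mathbb G$ if and only if $\mathbb F\succ\!\!\succ^{\mathbb B_0}\mathbb G$ for all bases $\mathbb B_0$ of $\mathcal H$ and the post-processing matrix $M$ can be chosen to be the same for all $\mathbb B_0$; that is, if and only if there is a single column-stochastic matrix $M$ such that $X(\mathbb G,\mathbb B_0)=M\,X(\mathbb F,\mathbb B_0)$ for every basis $\mathbb B_0$ of $\mathcal H$.
   Context: A basis $\mathbb B_0$ of $\mathcal H\cong\mathbb C^d$ means a set $\{P_j^{(0)}\}_{j=1}^d$ of rank-1 orthogonal projectors with $\sum_jP_j^{(0)}=I$. A POVM is a finite family $\mathbb F=\{F_i\}_i$ of operators on $\mathcal H$ with $F_i\ge0$ and $\sum_iF_i=I$. If two POVMs have different numbers of elements, the one with fewer elements is padded with zero operators so that both have the same number $n$ of elements. For a POVM $\mathbb F$ and a basis $\mathbb B_0$, $X(\mathbb F,\mathbb B_0)$ is the $n\times d$ column-stochastic matrix with entries $X_{ij}=\operatorname{Tr}(F_iP_j^{(0)})$. A stochastic matrix here is a column-stochastic matrix: nonnegative entries with each column summing to 1. One writes $\mathbb F\succ\!\!\succ^{\mathbb B_0}\mathbb G$ iff there is a stochastic matrix $M$ with $X(\mathbb G,\mathbb B_0)=M X(\mathbb F,\mathbb B_0)$. $\mathbb F$ is called a parent of $\mathbb G$ if there is a stochastic matrix $M$ such that $G_i=\sum_jM_{ij}F_j$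 for all $i$. *)

(* Defs.v *)
From HB Require Import structures.
From mathcomp Require Import all_boot all_order all_algebra.
From mathcomp Require Import spectral sesquilinear.
From mathcomp Require Import complex reals.

Set Implicit Arguments.
Unset Strict Implicit.
Unset Printing Implicit Defensive.

Import Order.TTheory GRing.Theory Num.Theory.

Local Open Scope ring_scope.
Local Open Scope complex_scope.
Local Open Scope sesquilinear_scope.

(* The order of R[i] is partial: [0 <= z] says that z is real and nonnegative.
   Hence this condition on all vectors also forces A to be self-adjoint. *)
Definition psd (R : realType) (d : nat) (A : 'M[R[i]]_d) : Prop :=
  forall v : 'cV[R[i]]_d, 0 <= (v ^t* *m A *m v) 0 0.

Definition is_povm (R : realType) (d n : nat) (F : 'I_n -> 'M[R[i]]_d) : Prop :=
  (forall i, psd (F i)) /\ \sum_(i < n) F i = 1%:M.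

Definition rank1_projector (R : realType) (d : nat) (P : 'M[R[i]]_d) : Prop :=
  [/\ P ^t* = P, P *m P = P & \rank P = 1%N].

(* Mutual orthogonality of the projectors follows from the completeness
   relation. *)
Definition is_basis (R : realType) (d : nat) (B : 'I_d -> 'M[R[i]]_d) : Prop :=
  (forall j, rank1_projector (B j)) /\ \sum_(j < d) B j = 1%:M.

(* Entries are taken in R[i]; being [0 <=] they are real. *)
Definition column_stochastic (R : realType) (m n : nat) (M : 'M[R[i]]_(m, n))
    : Prop :=
  (forall i j, 0 <= M i j) /\ (forall j, \sum_(i < m) M i j = 1).

(* The family F followed by k - n zero operators (used with n <= k). *)
Definition pad (R : realType) (d n k : nat) (F : 'I_n -> 'M[R[i]]_d)
    (i : 'I_k) : 'M[R[i]]_d :=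
  if insub (i : nat) is Some j then F j else 0.

Definition Xmx (R : realType) (d n : nat) (F : 'I_n -> 'M[R[i]]_d)
    (B : 'I_d -> 'M[R[i]]_d) : 'M[R[i]]_(n, d) :=
  \matrix_(i < n, j < d) \tr (F i *m B j).

(* F and G are first padded to the same number of elements. *)
Definition parent (R : realType) (d m n : nat)
    (F : 'I_m -> 'M[R[i]]_d) (G : 'I_n -> 'M[R[i]]_d) : Prop :=
  exists M : 'M[R[i]]_(maxn m n), column_stochastic M /\
    forall i, pad G i = \sum_(j < maxn m n) M i j *: pad F j.

(* Main.v *)
Require Import Defs.
From HB Require Import structures.
From mathcomp Require Import all_boot all_order all_algebra.
From mathcomp Require Import spectral sesquilinear.
From mathcomp Require Import complex reals.

Set Implicit Arguments.
Unset Strict Implicit.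
Unset Printing Implicit Defensive.

Import Order.TTheory GRing.Theory Num.Theory.
Local Open Scope ring_scope.
Local Open Scope complex_scope.

(* The parent relation says that D_i = G_i - sum_j M_ij F_j vanishes for every
   i, the basis condition that Tr(D_i P) = 0 for every projector P of every
   basis.  These are equivalent because bases separate operators: a normal A
   whose diagonal vanishes in every basis vanishes in particular on its own
   eigenbasis, hence is 0; for general A this applies to A + A^*, so that
   A^* = -A, and then A is itself normal. *)

Local Open Scope sesquilinear_scope.

Lemma adjointD (C : numClosedFieldType) m n (A B : 'M[C]_(m, n)) :
  (A + B) ^t* = A ^t* + B ^t*.
Proof. by rewrite linearD map_mxD. Qed.

Lemma adjointM (C : numClosedFieldType) m n p
    (A : 'M[C]_(m, n)) (B : 'M[C]_(n, p)) :
  (A *m B) ^t* = B ^t* *m A ^t*.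
Proof. by rewrite trmx_mul map_mxM. Qed.

Lemma adjoint_delta (C : numClosedFieldType) m n (i : 'I_m) (j : 'I_n) :
  (delta_mx i j : 'M[C]_(m, n)) ^t* = delta_mx j i.
Proof. by rewrite trmx_delta map_delta_mx. Qed.

Lemma mxtrace_adjoint (C : numClosedFieldType) n (A : 'M[C]_n) :
  \tr (A ^t*) = Num.conj (\tr A).
Proof. by rewrite trace_map_mx mxtrace_tr. Qed.

Lemma mxtrace_mul_delta (K : comNzRingType) n (A : 'M[K]_n) (i j : 'I_n) :
  \tr (A *m delta_mx i j) = A j i.
Proof.
rewrite mxtrace_mulC /mxtrace (bigD1 i) //= big1 => [|k neq_ki].
  rewrite mxE (bigD1 j) //= big1 => [|l neq_lj].
    by rewrite mxE !eqxx mul1r !addr0.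
  by rewrite mxE (negbTE neq_lj) andbF mul0r.
by rewrite mxE big1 // => l _; rewrite mxE (negbTE neq_ki) mul0r.
Qed.

Section Bases.

Variables (R : realType) (d : nat).
Implicit Types A U : 'M[R[i]]_d.

(** The [j]-th matrix is the projector onto the line spanned by column [j] of [U ^t*], and these
    columns are orthonormal. *)
Lemma unitary_basis U :
  U \is unitarymx -> is_basis (fun j => U ^t* *m delta_mx j j *m U).
Proof.
move=> unitU; have /unitarymxP UUs := unitU.
split=> [j|]; last first.
  rewrite -mulmx_suml -mulmx_sumr -mx1_sum_delta mulmx1.
  (* Unitarity is defined by [U *m U ^t* = 1]; completeness needs the product in the other order,
     which is also 1 since [U] is square. *)
  by rewrite -[LHS]mul1mx mulmxA mulmxKtV.
split.
- by rewrite !adjointM adjoint_delta trmxCK mulmxA.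
- by rewrite !mulmxA mulmxtVK // -(mulmxA _ _ (delta_mx j j)) mul_delta_mx.
- rewrite mxrankMfree; last by rewrite row_free_unit unitarymx_unit.
  rewrite eqmxMfull; first exact: mxrank_delta.
  by rewrite row_full_unit unitarymx_unit ?trmxC_unitary.
Qed.

Lemma normal_eq0_on_bases A :
  A \is normalmx ->
  (forall B, is_basis B -> forall j : 'I_d, \tr (A *m B j) = 0) -> A = 0.
Proof.
move=> /orthomx_spectralP; rewrite invmx_unitary ?spectral_unitarymx //.
set U := spectralmx A; set s := spectral_diag A => defA trA0.
have unitU : U \is unitarymx by apply: spectral_unitarymx.
suff s0 : s = 0 by rewrite defA s0 linear0 mulmx0 mul0mx.
apply/rowP => j; rewrite [RHS]mxE.
(* Against the [j]-th projector of its eigenbasis, [A] has trace equal to the eigenvalue [s 0 j]. *)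
have := trA0 _ (unitary_basis unitU) j.
rewrite defA !mulmxA mulmxtVK // -!mulmxA mxtrace_mulC -!mulmxA.
by rewrite (unitarymxP unitU) mulmx1 mxtrace_mul_delta mxE eqxx mulr1n.
Qed.

Lemma eq0_on_bases A :
  (forall B, is_basis B -> forall j : 'I_d, \tr (A *m B j) = 0) -> A = 0.
Proof.
move=> trA0.
have AsN : A ^t* = - A.
  apply/eqP; rewrite -addr_eq0 addrC; apply/eqP.
  apply: normal_eq0_on_bases => [|B basisB j].
    by apply/normalmxP; rewrite adjointD trmxCK (addrC (A ^t*)).
  rewrite mulmxDl mxtraceD trA0 // add0r.
  (* As [B j] is self-adjoint, the trace of [A ^t* *m B j] is the conjugate of that of
     [A *m B j]. *)
  have [/(_ j) [Bs _ _] _] := basisB.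
  by rewrite -Bs -adjointM mxtrace_adjoint mxtrace_mulC trA0 // conjC0.
by apply: normal_eq0_on_bases => //; apply/normalmxP; rewrite AsN mulNmx mulmxN.
Qed.

(** By linearity of the trace, mixing the rows of X amounts to mixing the operators themselves. *)
Lemma mulmx_XmxE k (M : 'M[R[i]]_k) (F : 'I_k -> 'M[R[i]]_d) B i j :
  (M *m Xmx F B) i j = \tr ((\sum_l M i l *: F l) *m B j).
Proof.
rewrite mxE mulmx_suml raddf_sum; apply: eq_bigr => l _ /=.
by rewrite mxE -scalemxAl mxtraceZ.
Qed.

End Bases.

Local Close Scope sesquilinear_scope.

Theorem proposition6 (R : realType) (d m n : nat)
    (F : 'I_m -> 'M[R[i]]_d) (G : 'I_n -> 'M[R[i]]_d)
    (hF : is_povm F) (hG : is_povm G) :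
  parent F G <->
  exists M : 'M[R[i]]_(maxn m n), column_stochastic M /\
    forall B : 'I_d -> 'M[R[i]]_d, is_basis B ->
      Xmx (@pad R d n (maxn m n) G) B = M *m Xmx (@pad R d m (maxn m n) F) B.
Proof.
split=> -[M [stochM eqM]]; exists M; split=> //.
  by move=> B _; apply/matrixP => i j; rewrite mulmx_XmxE mxE eqM.
(* [M] is fixed before [B], so the difference is one operator that can be tested on every basis. *)
move=> i; apply/eqP; rewrite -subr_eq0; apply/eqP/eq0_on_bases => B /eqM eqX j.
by rewrite mulmxBl raddfB /= -mulmx_XmxE -eqX mxE subrr.
Qed.
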